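(* Consider an arbitrary $n$-node graph $G$ where each node has a unique $b$-bit identifier with $b = O(\log n)$, together with a subset $S \subseteq V$ of living vertices. There is a deterministic distributed algorithm that in $O(\log^4 n)$ rounds of the $\mathsf{CONGEST}$ model finds a subset $S' \subseteq S$ with $|S'| \ge |S|/2$ such that $S'$ is partitioned into disjoint clusters, no two of which are joined by an edge of $G$, each cluster having weak-diameter $O(\log^2 n)$ in $G$. Moreover, for each cluster $\mathcal{C}$, the algorithm provides a Steiner tree $T_{\mathcal{C}}$ with radius $O(\log^2 n)$ in $G$ whose set of terminal nodes is equal to $\mathcal{C}$, and each vertex of $G$ is in $O(\log n)$ of these Steiner trees.
   Context: $\mathsf{CONGEST}$ model: synchronous rounds on the network $G$; per round each node sends one $O(\log n)$-bit message to each neighbor; nodes initially know only local information. The weak-diameter of a vertex set $\mathcal{C}$ is the maximum distance in $G$ between two of its vertices. A Steiner tree for a cluster $\mathcal{C}$ is a subtree of $G$ containing all vertices of $\mathcal{C}$ (its terminal nodes) and possibly other vertices (non-terminal nodes). *)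

(* Defs.v *)
From mathcomp Require Import all_boot.
Set Implicit Arguments. Unset Strict Implicit. Unset Printing Implicit Defensive.

Definition Lg (n : nat) : nat := (trunc_log 2 n).+1.

(* Local output of a node.
   - inSp  : whether the node belongs to S'
   - label : identifier of its cluster (meaningful only if inSp)
   - trees : for each Steiner tree the node belongs to, the pair
             (cluster label of the tree, parent pointer), where the parent
             is given by the identifier of a neighbour, or None for the root. *)
Record Output := mkOutput {
  inSp  : bool;
  label : nat;
  trees : seq (nat * option nat)
}.

(* A deterministic distributed algorithm (uniform in n).
   - St : local state space
   - init n id inS nbrs : initial state of a node that knows n, its own
       identifier, whether it is living (in S), and the identifiers of its
       neighbours (local information)
   - send s j : message (a bit string) sent to the neighbour with id j
   - step s rcv : new state, where rcv j is the message received from the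
       neighbour with identifier j ([::] for non-neighbours)
   - rounds n : number of rounds executed
   - out s : the local output computed from the final state *)
Record Algo := mkAlgo {
  St : Type;
  init : nat -> nat -> bool -> seq nat -> St;
  send : St -> nat -> seq bool;
  step : St -> (nat -> seq bool) -> St;
  rounds : nat -> nat;
  out : St -> Output
}.

Section Exec.
Variables (A : Algo) (V : finType) (e : rel V) (id : V -> nat) (S : {set V}).

Definition nbr_ids (v : V) : seq nat := sort leq [seq id u | u <- enum V & e v u].

Fixpoint state (r : nat) : V -> St A :=
  match r with
  | 0 => fun v => @init A #|V| (id v) (v \in S) (nbr_ids v)
  | r'.+1 => fun v =>
      @step A (state r' v)
        (fun j => match [pick u | e v u && (id u == j)] with
                  | Some u => @send A (state r' u) (id v)
                  | None => [::]
                  end)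
  end.

Definition bandwidth_ok (B : nat) : Prop :=
  forall r u v, r < @rounds A #|V| -> e u v -> size (send (state r u) (id v)) <= B.

Definition output (v : V) : Output := @out A (state (@rounds A #|V|) v).
End Exec.

Section Spec.
Variables (V : finType) (e : rel V) (id : V -> nat) (S : {set V}) (o : V -> Output).

Definition dist_le (u v : V) (k : nat) : Prop :=
  exists p : seq V, [/\ path e u p, last u p = v & size p <= k].

Definition Sp : {set V} := [set v | inSp (o v)].

Definition in_tree (k : nat) (v : V) : bool := k \in map fst (trees (o v)).

Definition tree_par (k : nat) (v w : V) : bool := (k, Some (id w)) \in trees (o v).

Definition is_cluster_label (k : nat) : bool := [exists u, inSp (o u) && (label (o u) == k)].

Definition steiner_tree_ok (k rad : nat) : Prop :=
  [/\
      (forall v j, (k, Some j) \in trees (o v) ->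
          exists w, [/\ id w = j, e v w & in_tree k w]),
      (* there is a unique root, reached from every tree node along parent
         pointers within rad steps (hence connected, acyclic, radius <= rad) *)
      (exists r : V, (k, None) \in trees (o r) /\
          (forall r', (k, None) \in trees (o r') -> r' = r) /\
          (forall v, in_tree k v ->
              exists p : seq V, [/\ path (tree_par k) v p, last v p = r & size p <= rad]))
    &
      (forall v, inSp (o v) -> label (o v) = k -> in_tree k v)].

Definition theorem2p2_spec (c : nat) : Prop :=
  let L := Lg #|V| in
  [/\ Sp \subset S,
      #|S| <= 2 * #|Sp|,
      (forall u v, e u v -> u \in Sp -> v \in Sp -> label (o u) = label (o v)),
      (forall u v, u \in Sp -> v \in Sp -> label (o u) = label (o v) ->
          dist_le u v (c * L ^ 2))
    & [/\ (forall v, uniq (map fst (trees (o v)))),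
      (forall k, is_cluster_label k -> steiner_tree_ok k (c * L ^ 2))
    &
      (forall v, count is_cluster_label (map fst (trees (o v))) <= c * L)]].
End Spec.

(* Main.v *)
(** Every living vertex starts as a cluster whose label is its identifier, at
    level 0 and with one token. In a step, a vertex having a neighbour in a
    cluster of smaller key (smaller level or, at the same level, next label bit 0
    instead of 1) proposes to join such a cluster of minimal key. A cluster with
    at least a 1/K fraction of its tokens in proposals accepts them all and gains
    one token for each; otherwise the proposing vertices die and the cluster pays
    K/2 tokens for each, which costs at most half of its tokens. A phase has K
    steps, and a cluster that refused in it reaches the next level at its end:
    adjacent clusters agree on as many low label bits as their levels allow.

    In a phase a cluster either doubles its tokens or gains a level while keeping
    half of them, so tokens * 4^level doubles, and after O(log n) phases every
    cluster has used all bits of its label: adjacent vertices then share their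
    cluster. Keys only decrease by moves and grow by at most 3 in a phase, hence a
    vertex joins O(log n) clusters; this bounds the tokens ever created, hence the
    deaths, and the number of Steiner trees at a vertex. Depths grow by one in a
    step, giving radius O(log^2 n).

    A step takes O(log^2 n) rounds: in every round one bit per tree crosses an
    edge, and the numbers of proposals are added up towards the roots
    bit-serially, least significant bit first. *)
Require Import Defs.
From mathcomp Require Import all_boot.
From mathcomp Require Import zify.
From Stdlib Require Import FunctionalExtensionality.
Set Implicit Arguments. Unset Strict Implicit. Unset Printing Implicit Defensive.

(** * Binary encodings *)

Definition bitn (i n : nat) : bool := odd (n %/ 2 ^ i).

Lemma bitn_mod i m n : m = n %[mod 2 ^ i.+1] -> bitn i m = bitn i n.
Proof.
suff h a : bitn i a = bitn i (a %% 2 ^ i.+1) by move=> mn; rewrite h mn -h.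
rewrite /bitn {1}(divn_eq a (2 ^ i.+1)) expnS mulnA divnMDl ?expn_gt0 //.
by rewrite oddD oddM andbF.
Qed.

Lemma modn_exp2S n i : n %% 2 ^ i.+1 = n %% 2 ^ i + 2 ^ i * bitn i n.
Proof.
have e2 : n = (n %/ 2 ^ i)./2 * 2 ^ i.+1 + (n %% 2 ^ i + 2 ^ i * bitn i n).
  have h1 := divn_eq n (2 ^ i); have h2 := odd_double_half (n %/ 2 ^ i).
  rewrite expnS {1}h1 -{1}h2 -/(bitn i n) mulnDl -muln2; lia.
have lt2 : n %% 2 ^ i + 2 ^ i * bitn i n < 2 ^ i.+1.
  have := ltn_pmod n (expn_gt0 2 i); rewrite expnS.
  by case: (bitn i n); lia.
by rewrite {1}e2 modnMDl modn_small.
Qed.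

Lemma sum_bitn n t : \sum_(i < t) 2 ^ i * bitn i n = n %% 2 ^ t.
Proof.
elim: t => [|t IHt]; first by rewrite big_ord0 expn0 modn1.
by rewrite big_ord_recr /= IHt modn_exp2S.
Qed.

Definition enc (n : nat) : seq bool := mkseq (bitn^~ n) (trunc_log 2 n).+1.
Definition dec (s : seq bool) : nat := \sum_(i < size s) 2 ^ i * nth false s i.

Lemma encK : cancel enc dec.
Proof.
move=> n; rewrite /dec /enc size_mkseq.
rewrite (eq_bigr (fun i : 'I__ => 2 ^ i * bitn i n)); last by move=> i _; rewrite nth_mkseq.
by rewrite sum_bitn modn_small // trunc_log_ltn.
Qed.

Lemma size_enc n w : 0 < w -> n < 2 ^ w -> size (enc n) <= w.
Proof.
move=> w0 nw; rewrite size_mkseq.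
case: n nw => [|n] nw; first by rewrite trunc_log0.
rewrite -(@ltn_exp2l 2) //; apply: leq_ltn_trans nw.
exact: trunc_logP.
Qed.

(** * Choosing a neighbour *)

Section Select.
Variables (X : Type) (al : X -> bool) (ky : X -> nat) (bound : nat).

(** Ties go to the leftmost element. The type is arbitrary because the process compares vertices and
    the protocol compares identifiers. *)
Fixpoint select (s : seq X) : option X :=
  if s is x :: s' then
    if al x && (ky x < bound) then
      if select s' is Some y then if ky x <= ky y then Some x else Some y
      else Some x
    else select s'
  else None.

End Select.

Lemma select_map (X Y : Type) (f : X -> Y) al ky b s :
  select al ky b (map f s) = omap f (select (al \o f) (ky \o f) b s).
Proof.
elim: s => //= x s ->; case: ifP => // _.
by case: (select _ _ _ s) => //= y; case: ifP.
Qed.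

(** Keys need to agree on allowed elements only, since what dead neighbours tell may be meaningless;
    the second conjunct gives the induction an allowed winner. *)
Lemma eq_select (X : eqType) (al1 al2 : X -> bool) (k1 k2 : X -> nat) b s :
    {in s, al1 =1 al2} -> {in s, forall x, al1 x -> k1 x = k2 x} ->
  select al1 k1 b s = select al2 k2 b s /\
  (forall x, select al1 k1 b s = Some x -> x \in s /\ al1 x).
Proof.
elim: s => [|x s IHs] ha hk //=.
have [|| <- hs] := IHs.
- by move=> y ys; apply: ha; rewrite inE ys orbT.
- by move=> y ys; apply: hk; rewrite inE ys orbT.
have ax := ha x (mem_head _ _); have kx := hk x (mem_head _ _).
rewrite -ax; case a1: (al1 x) => /=; last first.
  by split=> // y /hs[ys ay]; rewrite inE ys orbT.
rewrite -kx //; case: ifP => _; last first.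
  by split=> // y /hs[ys ay]; rewrite inE ys orbT.
case E: (select al1 k1 b s) hs => [y|] hs; last first.
  by split=> // z [<-]; rewrite mem_head.
have [ys ay] := hs y erefl.
rewrite (hk y) ?inE ?ys ?orbT //; split=> //.
by move=> z; case: ifP => _ [<-]; rewrite inE ?ys ?eqxx ?orbT.
Qed.

Lemma select_None (X : eqType) (al : X -> bool) ky b s x :
  select al ky b s = None -> x \in s -> al x -> b <= ky x.
Proof.
elim: s => //= y s IH; case: ifP => [_|/negbT ny].
  by case: (select _ _ _ s) => // u; case: ifP.
move=> E; rewrite inE => /orP[/eqP-> ay|]; last exact: IH.
by move: ny; rewrite ay /= -leqNgt.
Qed.

Lemma selectP (X : eqType) (al : X -> bool) ky b s x :
  select al ky b s = Some x ->
  [/\ x \in s, al x, ky x < b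
    & forall y, y \in s -> al y -> ky x <= ky y].
Proof.
elim: s x => //= y s IHs x.
case: ifP => [/andP[ay yb]|ny]; last first.
  move=> /IHs[xs ax xb hx]; rewrite inE xs orbT; split=> // z.
  rewrite inE => /orP[/eqP-> az| /hx //].
  by apply: ltnW; move: ny; rewrite az /= ltnNge => /negbFE; apply: leq_trans.
case E: (select al ky b s) => [z|]; last first.
  case=> <-; rewrite mem_head; split=> // z; rewrite inE => /orP[/eqP-> //|zs az].
  exact: leq_trans (ltnW yb) (select_None E zs az).
have [zs az zb hz] := IHs z E.
case: ifP => [yz|/negbT nyz] [<-]; rewrite inE ?eqxx ?zs ?orbT; split=> // t.
- by rewrite inE => /orP[/eqP-> //|ts /(hz _ ts)]; apply: leq_trans.
- by rewrite inE => /orP[/eqP-> _|/hz //]; lia.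
Qed.

(** * The clustering process *)

Definition entry : Type := nat * option nat * nat.
Definition lab (x : entry) : nat := x.1.1.
Definition par (x : entry) : option nat := x.1.2.
Definition dep (x : entry) : nat := x.2.
Definition entry0 : entry := (0, None, 0).

Definition labs (s : seq entry) : seq nat := map lab s.
Definition lookup (s : seq entry) (k : nat) : entry := nth entry0 s (index k (labs s)).

Lemma lookup_mem s k : k \in labs s -> lookup s k \in s.
Proof. by move=> ks; rewrite mem_nth // -(size_map lab) index_mem. Qed.

Lemma lab_lookup s k : k \in labs s -> lab (lookup s k) = k.
Proof.
by move=> ks; rewrite /lookup -(nth_map _ 0) ?nth_index // -(size_map lab) index_mem.
Qed.

Lemma lookup_uniq s x : uniq (labs s) -> x \in s -> lookup s (lab x) = x.
Proof.
move=> us xs; rewrite /lookup -{2}(nth_index entry0 xs); congr nth.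
have xi : index x s < size s by rewrite index_mem.
by rewrite -{1}(nth_index entry0 xs) -(nth_map _ 0) // index_uniq // size_map.
Qed.

Lemma labs_rcons s x : labs (rcons s x) = rcons (labs s) (lab x).
Proof. by rewrite /labs map_rcons. Qed.

(* Twice the level plus the colour, i.e. the first bit of the label that has
   not been used yet; vertices move towards smaller keys. *)
Definition keyof (l k : nat) : nat := l.*2 + bitn l k.

Section Process.
Variables (V : finType) (e : rel V) (idn : V -> nat) (S : {set V}).
Hypothesis e_sym : symmetric e.
Hypothesis idn_inj : injective idn.

(** Level and tokens belong to a cluster and are indexed by its label. Entries never leave [forest]:
    vertices that moved away or died still serve the trees they joined. *)
Record conf := Conf {
  alive : V -> bool;
  cluster : V -> nat;
  level : nat -> nat;
  tokens : nat -> nat;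
  forest : V -> seq entry }.

(** Sorting by identifier makes ties break as in the sorted list of identifiers that a node
    knows. *)
Definition nbrs (v : V) : seq V := sort (relpre idn leq) [seq u <- enum V | e v u].

Lemma mem_nbrs v u : (u \in nbrs v) = e v u.
Proof. by rewrite mem_sort mem_filter mem_enum andbT. Qed.

Lemma nbr_idsE v : nbr_ids e idn v = map idn (nbrs v).
Proof. by rewrite /nbr_ids sort_map. Qed.

Implicit Types (a : conf) (u v : V) (k : nat).

Definition key a k := keyof (level a k) k.

Definition prop a v : option V :=
  if alive a v then
    select (alive a) (fun u => key a (cluster a u)) (key a (cluster a v)) (nbrs v)
  else None.

Definition nprop a k : nat := #|[set v | omap (cluster a) (prop a v) == Some k]|.

Lemma propP a v u : prop a v = Some u ->
  [/\ alive a v, alive a u, e v u, key a (cluster a u) < key a (cluster a v)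
    & forall w, e v w -> alive a w -> key a (cluster a u) <= key a (cluster a w)].
Proof.
rewrite /prop; case: ifP => // av /selectP[]; rewrite mem_nbrs => evu au lt h.
by split=> // w evw aw; apply: h; rewrite ?mem_nbrs.
Qed.

Lemma prop_None a v w : prop a v = None -> alive a v -> e v w -> alive a w ->
  key a (cluster a v) <= key a (cluster a w).
Proof.
by rewrite /prop => + av evw aw; rewrite av => /select_None; apply; rewrite ?mem_nbrs.
Qed.

Section Step.
Variables (K M : nat) (last : bool).

(** A cluster with tokens but no proposals refuses, so idle clusters also gain a level. *)
Definition ok a k : bool := tokens a k <= K * nprop a k.

Definition step_alive a v : bool :=
  alive a v && (if prop a v is Some u then ok a (cluster a u) else true).

Definition step_cluster a v : nat :=
  if prop a v is Some u then
    if ok a (cluster a u) then cluster a u else cluster a v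
  else cluster a v.

Definition step_level a k : nat := level a k + (last && ~~ ok a k).

Definition step_tokens a k : nat :=
  if ok a k then tokens a k + nprop a k else tokens a k - M * nprop a k.

Definition step_forest a v : seq entry :=
  if prop a v is Some u then
    let k := cluster a u in
    if ok a k && (k \notin labs (forest a v)) then
      rcons (forest a v) (k, Some (idn u), (dep (lookup (forest a u) k)).+1)
    else forest a v
  else forest a v.

Definition astep a : conf := {|
  alive := step_alive a; cluster := step_cluster a; level := step_level a;
  tokens := step_tokens a; forest := step_forest a |}.

(** * Separation of clusters *)

Definition agree a : Prop := forall u v, e u v -> alive a u -> alive a v ->
  cluster a u = cluster a v %[mod 2 ^ minn (level a (cluster a u)) (level a (cluster a v))].

Lemma eqn_mod_exp2 i j x y : i <= j -> x = y %[mod 2 ^ j] -> x = y %[mod 2 ^ i].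
Proof.
move=> ij xy.
by rewrite -(modn_dvdm x (dvdn_exp2l 2 ij)) xy modn_dvdm // dvdn_exp2l.
Qed.

Lemma key_level a j k : key a j <= key a k -> level a j <= level a k.
Proof. by rewrite /key /keyof; case: bitn; case: bitn; lia. Qed.

Lemma step_cluster_level a v : level a (step_cluster a v) <= level a (cluster a v).
Proof.
rewrite /step_cluster; case E: (prop a v) => [u|//]; case: ifP => // _.
by have [_ _ _ /ltnW/key_level] := propP E.
Qed.

Lemma step_cluster_agree a v : agree a ->
  step_cluster a v = cluster a v %[mod 2 ^ level a (step_cluster a v)].
Proof.
move=> ag; rewrite /step_cluster; case E: (prop a v) => [u|//]; case: ifP => // _.
have [av au evu lt _] := propP E.
have := ag u v; rewrite e_sym => /(_ evu au av).
by rewrite (minn_idPl _) //; apply/key_level/ltnW.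
Qed.

Lemma agree_step_cluster a u v : agree a -> e u v -> alive a u -> alive a v ->
  step_cluster a u = step_cluster a v %[mod 2 ^ minn (level a (step_cluster a u)) (level a (step_cluster a v))].
Proof.
move=> ag euv au av; set m := minn _ _.
have mu : m <= level a (step_cluster a u) by rewrite geq_minl.
have mv : m <= level a (step_cluster a v) by rewrite geq_minr.
rewrite (eqn_mod_exp2 mu (step_cluster_agree u ag)) (eqn_mod_exp2 mv (step_cluster_agree v ag)).
apply: eqn_mod_exp2 (ag _ _ euv au av); rewrite leq_min.
by rewrite (leq_trans mu (step_cluster_level _ _)) (leq_trans mv (step_cluster_level _ _)).
Qed.

(* After a refusal no neighbour of the cluster has a larger key: such a
   neighbour proposed, to a cluster of minimal key, and either died or
   moved to that cluster. *)
Lemma refused_key a u v : e u v -> step_alive a u -> step_alive a v ->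
  ~~ ok a (step_cluster a u) -> key a (step_cluster a v) <= key a (step_cluster a u).
Proof.
move=> euv; rewrite /step_alive => /andP[au hu] /andP[av hv] nok.
have uu : step_cluster a u = cluster a u.
  by move: nok; rewrite /step_cluster; case: (prop a u) hu => // w okw; rewrite okw okw.
rewrite uu in nok *; rewrite /step_cluster.
rewrite e_sym in euv; case E: (prop a v) hv => [w|]; last first.
  by move=> _; apply: prop_None E av euv au.
by move=> okw; rewrite okw; have [_ _ _ _] := propP E; apply.
Qed.

(** If exactly one of the two clusters refuses, its level is at least the other one, so the minimum
    of the levels grows only when both refuse. Then neither key is smaller, hence the levels and the
    next label bits coincide, and one more bit agrees. *)
Lemma agree_step a : agree a -> agree (astep a).
Proof.
move=> ag u v euv /= su sv.
have /andP[au _] := su; have /andP[av _] := sv.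
have := agree_step_cluster ag euv au av.
have vu := euv; rewrite e_sym in vu.
have := refused_key euv su sv; have := refused_key vu sv su.
move: (step_cluster a u) (step_cluster a v) => j k; rewrite /step_level.
case: last => /=; last by rewrite !addn0.
rewrite /key; case: (ok a j) => /=; case: (ok a k) => /= hk hj.
- by rewrite !addn0.
- rewrite addn0 addn1; have le := key_level (hk isT).
  by rewrite (minn_idPl le) (minn_idPl (leqW le)).
- rewrite addn0 addn1; have le := key_level (hj isT).
  by rewrite (minn_idPr le) (minn_idPr (leqW le)).
have ee : keyof (level a j) j = keyof (level a k) k.
  by apply/eqP; rewrite eqn_leq hk // hj.
have el : level a j = level a k.
  by apply/eqP; rewrite eqn_leq; apply/andP; split; apply: key_level; rewrite /key ee.
rewrite -el !minnn !addn1 !modn_exp2S => ->.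
by move: ee; rewrite /keyof -el => /addnI ->.
Qed.

(** * Accounting of tokens *)

Hypothesis M2K : 2 * M <= K.

(** Less than a 1/K fraction proposed, and [M] is at most half of [K]. Hence the subtraction in
    [step_tokens] is never truncated after a refusal. *)
Lemma nprop_refused a k : ~~ ok a k -> 2 * (M * nprop a k) < tokens a k.
Proof.
rewrite /ok -ltnNge; apply: leq_ltn_trans.
by rewrite mulnA leq_mul2r M2K orbT.
Qed.

Lemma step_tokens_half a k : tokens a k <= 2 * step_tokens a k.
Proof.
rewrite /step_tokens; case: ifP => [_|/negbT/nprop_refused]; lia.
Qed.

(** Depths drop by one along parent pointers, which makes the trees acyclic. By [wf_self] the root
    of a tree stays in place even after it moved or died. *)
Record wf (s : nat) (a : conf) : Prop := Wf {
  wf_alive : forall v, alive a v -> v \in S;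
  wf_cluster : forall v, alive a v -> cluster a v \in labs (forest a v);
  wf_uniq : forall v, uniq (labs (forest a v));
  wf_root : forall v x, x \in forest a v -> par x = None -> lab x = idn v /\ dep x = 0;
  wf_par : forall v x j, x \in forest a v -> par x = Some j ->
    exists u y, [/\ idn u = j, e v u, y \in forest a u, lab y = lab x & dep x = (dep y).+1];
  wf_center : forall v k, k \in labs (forest a v) -> exists2 r, r \in S & idn r = k;
  wf_self : forall r, r \in S -> (idn r, None, 0) \in forest a r;
  wf_dep : forall v x, x \in forest a v -> dep x <= s }.

Lemma forest_sub a v : {subset forest a v <= step_forest a v}.
Proof.
move=> x xv; rewrite /step_forest; case: prop => // u; case: ifP => // _.
by rewrite mem_rcons inE xv orbT.
Qed.

Variant step_entry_spec a v (x : entry) : Prop :=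
  | OldEntry of x \in forest a v
  | NewEntry u of prop a v = Some u & cluster a u \notin labs (forest a v)
      & x = (cluster a u, Some (idn u), (dep (lookup (forest a u) (cluster a u))).+1).

Lemma step_entryP a v x : x \in step_forest a v -> step_entry_spec a v x.
Proof.
rewrite /step_forest; case E: prop => [u|]; last exact: OldEntry.
case: ifP => [/andP[_ nk]|_]; last exact: OldEntry.
by rewrite mem_rcons inE => /orP[/eqP xe|]; [apply: NewEntry E nk xe | apply: OldEntry].
Qed.

Lemma wf_step s a : wf s a -> wf s.+1 (astep a).
Proof.
case=> hal hcl hun hrt hpa hce hse hde.
have lab_sub v : {subset labs (forest a v) <= labs (step_forest a v)}.
  by move=> k /mapP[x xv ->]; apply/map_f/forest_sub.
have lk v : alive a v -> lookup (forest a v) (cluster a v) \in forest a v.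
  by move=> av; apply/lookup_mem/hcl.
split=> /=.
- by move=> v /andP[/hal].
- move=> v /andP[av ov]; rewrite /step_cluster /step_forest.
  case: (prop a v) ov => [u oku|_]; last exact: hcl.
  rewrite oku /=; case: ifP => [_|/negbT]; last by rewrite negbK.
  by rewrite labs_rcons mem_rcons mem_head.
- move=> v; rewrite /step_forest; case: prop => // u; case: ifP => // /andP[_ nk].
  by rewrite labs_rcons rcons_uniq nk hun.
- by move=> v x /step_entryP[xv|u _ _ -> //]; apply: hrt.
- move=> v x j /step_entryP[xv /(hpa _ _ _ xv)|u pu _ ->] /=.
    by case=> u [y [? ? yu ? ?]]; exists u, y; split=> //; apply: forest_sub.
  case=> <-; have [av au evu _ _] := propP pu.
  exists u, (lookup (forest a u) (cluster a u)); split=> //.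
    exact/forest_sub/lk.
  by rewrite lab_lookup ?hcl.
- move=> v k /mapP[x /step_entryP[xv ->|u pu _ -> ->]]; first exact/(hce v)/map_f.
  by have [_ au _ _ _] := propP pu; apply/(hce u)/hcl.
- by move=> r rS; apply/forest_sub/hse.
- move=> v x /step_entryP[/hde|u pu _ ->]; first exact: leqW.
  by have [_ au _ _ _] := propP pu; apply: hde (lk _ au).
Qed.

(** Double counting: each proposal is counted at the only vertex whose identifier is the label of
    the proposed cluster. *)
Lemma sum_nprop s a (f : nat -> nat) : wf s a ->
  \sum_(r in S) f (idn r) * nprop a (idn r) =
  \sum_(v in S) (if prop a v is Some u then f (cluster a u) else 0).
Proof.
move=> wa.
have npE k : nprop a k = \sum_(v in S) (omap (cluster a) (prop a v) == Some k).
  rewrite /nprop -sum1_card [LHS]big_mkcond [RHS]big_mkcond; apply: eq_bigr => v _.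
  rewrite inE; case: ifP => [/eqP E|_]; last by case: ifP.
  by case F: (prop a v) E => [u|//] _; have [/(wf_alive wa)->] := propP F.
under eq_bigr do rewrite npE big_distrr.
rewrite exchange_big; apply: eq_bigr => v vS /=.
case E: (prop a v) => [u|] /=; last by rewrite big1 // => r _; rewrite muln0.
have [_ au _ _ _] := propP E.
have [r rS <-] := wf_center wa (wf_cluster wa au).
rewrite (bigD1 r) //= eqxx muln1 big1 ?addn0 // => q /andP[_ qr].
by rewrite (_ : (_ == _) = false) ?muln0 //; apply: contraNF qr => /eqP[/idn_inj->].
Qed.

(** Of the 3, two come from the level and one from a next label bit that may turn from 0 to 1. *)
Lemma key_step a k : keyof (step_level a k) k <= key a k + 3 * last.
Proof.
rewrite /step_level /key /keyof; case: last; last by rewrite /= !addn0.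
by have := leq_b1 (bitn (level a k + (true && ~~ ok a k)) k); case: ok; lia.
Qed.

(** Potential function: a move turns at least one unit of key into one token, and a death turns [M]
    tokens into the [M] units charged to the dead vertex. *)
Definition credit a : nat :=
  \sum_(r in S) tokens a (idn r) +
  \sum_(v in S) (if alive a v then key a (cluster a v) else M).

Lemma credit_step s a : wf s a ->
  credit (astep a) <= credit a + 3 * last * #|S|.
Proof.
move=> wa; rewrite /credit /=.
pose won v := if prop a v is Some u then ok a (cluster a u) : nat else 0.
pose lost v := if prop a v is Some u then ~~ ok a (cluster a u) * M else 0.
have tokE : \sum_(r in S) step_tokens a (idn r) + \sum_(v in S) lost v =
            \sum_(r in S) tokens a (idn r) + \sum_(v in S) won v.
  rewrite -(sum_nprop (fun k => ok a k : nat) wa).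
  rewrite -(sum_nprop (fun k => ~~ ok a k * M) wa) -!big_split.
  apply: eq_bigr => r _ /=; rewrite /step_tokens.
  case: ifP => [_|/negbT nok] /=; first by lia.
  by have := nprop_refused nok; lia.
have : \sum_(v in S) (if step_alive a v then
                        keyof (step_level a (step_cluster a v)) (step_cluster a v)
                      else M) + \sum_(v in S) won v <=
   \sum_(v in S) (if alive a v then key a (cluster a v) else M) + \sum_(v in S) lost v
   + \sum_(v in S) 3 * last.
  rewrite -!big_split; apply: leq_sum => v _ /=.
  rewrite /step_alive /step_cluster /won /lost.
  case E: (prop a v) => [u|]; last first.
    by rewrite andbT; case: ifP => _; have := key_step a (cluster a v); lia.
  have [-> _ _ lt _] := propP E; case: ifP => /= oku.
    by rewrite oku /=; have := key_step a (cluster a u); lia.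
  by rewrite oku /=; lia.
rewrite sum_nat_const /key /=; lia.
Qed.

(** A new entry comes with a move, which pays for it by lowering the key; only the end of a phase
    can raise the sum. *)
Lemma forest_step a v :
  size (step_forest a v) + (if step_alive a v then
      keyof (step_level a (step_cluster a v)) (step_cluster a v) else 0)
  <= size (forest a v) + (if alive a v then key a (cluster a v) else 0) + 3 * last.
Proof.
rewrite /step_alive /step_cluster /step_forest.
case E: (prop a v) => [u|]; last first.
  by rewrite andbT; case: ifP => _; have := key_step a (cluster a v); lia.
have [-> _ _ lt _] := propP E; case oku: (ok a (cluster a u)) => /=; last by lia.
by have := key_step a (cluster a u); case: ifP; rewrite ?size_rcons; lia.
Qed.

End Step.

(** Keys do not change inside a phase, so by [refused_key] no surviving neighbour of the cluster has
    a larger key. *)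
Lemma refused_idle K M a k : ~~ ok K a k -> nprop (astep K M false a) k = 0.
Proof.
move=> nok; apply/eqP; rewrite cards_eq0; apply/eqP/setP=> v; rewrite !inE.
case E: (prop _ v) => [u|//] /=; apply/negP=> /eqP[uk].
have [av au evu lt _] := propP E.
have euv : e u v by rewrite e_sym.
have : key a (step_cluster K a v) <= key a (step_cluster K a u).
  by apply: refused_key euv au av _; rewrite uk.
move: lt; rewrite /key /= /step_level /= !addn0; lia.
Qed.

End Process.

(** * Running the process for all phases *)

Section Run.
Variables (V : finType) (e : rel V) (idn : V -> nat) (S : {set V}).
Hypothesis e_sym : symmetric e.
Hypothesis idn_inj : injective idn.
Variable P : nat.
Hypothesis P0 : 0 < P.

(** For [P] at least 2 the price is at least twice [3 * P + 2], the credit per vertex of [S] over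
    [P] phases, so at most half of [S] dies. Doubling the price gives [nsteps]. *)
Definition nsteps : nat := 16 * P.
Definition price : nat := 8 * P.
Local Notation K := nsteps.
Local Notation M := price.

Definition start : conf V := {|
  alive := fun v => v \in S;
  cluster := idn;
  level := fun=> 0;
  tokens := fun=> 1;
  forest := fun v => if v \in S then [:: (idn v, None, 0)] else [::] |}.

Fixpoint run (s : nat) : conf V :=
  if s is s'.+1 then astep e idn K M (K %| s) (run s') else start.

Lemma K_gt0 : 0 < K. Proof. by rewrite /nsteps; lia. Qed.
Lemma M2K : 2 * M <= K. Proof. by rewrite /nsteps /price; lia. Qed.

Lemma run_wf s : wf e idn S s (run s).
Proof.
elim: s => [|s IHs]; last exact: wf_step IHs.
split=> //=.
- by move=> v ->; rewrite mem_head.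
- by move=> v; case: ifP.
- by move=> v x; case: ifP => // _; rewrite inE => /eqP->.
- by move=> v x j; case: ifP => // _; rewrite inE => /eqP->.
- move=> v k; case: ifP => // vS; rewrite inE => /eqP->; by exists v.
- by move=> r ->; rewrite mem_head.
- by move=> v x; case: ifP => // _; rewrite inE => /eqP->.
Qed.

Lemma run_agree s : agree e (run s).
Proof.
elim: s => [|s IHs]; last exact: agree_step.
by move=> u v _ _ _ /=; rewrite minnn expn0 !modn1.
Qed.

Lemma run_credit s : credit idn S M (run s) <= #|S| * (3 * (s %/ K) + 2).
Proof.
elim: s => [|s IHs].
  rewrite div0n muln0 add0n /credit /= sum1_card -(mul1n 2) mulnA muln1 muln2 -addnn leq_add2l.
  rewrite -[leqRHS]sum1_card; apply: leq_sum => v -> /=.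
  exact: leq_b1.
apply: leq_trans (credit_step idn_inj _ M2K (run_wf s)) _.
have -> : #|S| * (3 * (s.+1 %/ K) + 2) = #|S| * (3 * (s %/ K) + 2) + 3 * (K %| s.+1) * #|S|.
  by rewrite (divnS _ K_gt0) [in RHS](mulnC (3 * _)) -mulnDr; congr (_ * _); lia.
by rewrite leq_add2r.
Qed.

Lemma run_forest s v : size (forest (run s) v) +
    (if alive (run s) v then key (run s) (cluster (run s) v) else 0) <= 3 * (s %/ K) + 2.
Proof.
elim: s => [|s IHs] /=.
  by rewrite div0n; case: ifP => //= _; rewrite /key /keyof /=; case: bitn.
have := forest_step e idn (K %| s.+1) M2K (run s) v; rewrite /key /=.
by rewrite (divnS _ K_gt0); move: IHs; rewrite /key; lia.
Qed.

Lemma run_tokens s r : r \in S -> tokens (run s) (idn r) <= #|S| * (3 * (s %/ K) + 2).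
Proof.
move=> rS; apply: leq_trans (run_credit s); rewrite /credit (bigD1 r) //=; lia.
Qed.

Lemma step_tokens_ok a b k : ok e idn K a k ->
  tokens (astep e idn K M b a) k = tokens a k + nprop e idn a k.
Proof. by rewrite /= /step_tokens => ->. Qed.

Lemma step_half a b k : tokens a k <= 2 * tokens (astep e idn K M b a) k.
Proof. exact: step_tokens_half M2K a k. Qed.

(** The first alternative is acceptance in all [i] steps, each gaining at least a 1/K fraction of
    the initial tokens; it is multiplied by [K] to stay in the naturals. The second is the idle
    state after a refusal. *)
Lemma run_phase ph i k : 0 < tokens (run (ph * K)) k -> i < K ->
  let a0 := run (ph * K) in let a := run (ph * K + i) in
  level a k = level a0 k /\
  ((K + i) * tokens a0 k <= K * tokens a k \/
   (nprop e idn a k = 0 /\ tokens a0 k <= 2 * tokens a k)).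
Proof.
move=> t0 /=; set t := tokens (run (ph * K)) k in t0 *.
elim: i => [|i IHi] iK; first by rewrite !addn0; split=> //; left.
have [lE tE] := IHi (ltnW iK).
have nl : K %| (ph * K + i).+1 = false.
  by rewrite -addnS (dvdn_addr _ (dvdn_mull ph (dvdnn K))) gtnNdvd.
have K0 := K_gt0.
rewrite addnS [run _.+1]/= nl; set a := run _ in lE tE *.
split; first by rewrite /= /step_level addn0.
have half := step_half a false k; have okE := @step_tokens_ok a false k.
case oka: (ok e idn K a k); last first.
  right; split; first by apply: (refused_idle e_sym); rewrite oka.
  case: tE => [tE|[np tE]]; first by nia.
  by rewrite /= /step_tokens oka np muln0 subn0.
have le := oka; rewrite /ok in le.
left; case: tE => [tE|[np tE]]; rewrite okE //; first by nia.
(* An idle cluster cannot have accepted, as it still holds a positive number of tokens. *)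
by move: le; rewrite np muln0; lia.
Qed.

(* Over a phase a cluster either accepts in every step, and doubles its
   tokens, or reaches the next level and keeps half of them. *)
Lemma run_growth ph r : r \in S ->
  2 ^ ph <= tokens (run (ph * K)) (idn r) * 4 ^ level (run (ph * K)) (idn r).
Proof.
move=> rS; set k := idn r; elim: ph => [|ph IHph] //.
have K0 := K_gt0; set a0 := run (ph * K) in IHph.
have t0 : 0 < tokens a0 k.
  by rewrite lt0n; apply: contraTneq IHph => ->; rewrite mul0n -ltnNge expn_gt0.
have [|lE tE] := @run_phase ph K.-1 k t0 _; first by rewrite prednK.
have -> : ph.+1 * K = (ph * K + K.-1).+1 by rewrite mulSn -addnS prednK // addnC.
rewrite [run _.+1]/=; set a := run _ in lE tE *.
have -> : K %| (ph * K + K.-1).+1 by rewrite -addnS prednK // (dvdn_addr _ (dvdn_mull ph (dvdnn K))) dvdnn.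
suff h t l : tokens (astep e idn K M true a) k = t -> level (astep e idn K M true a) k = l ->
    2 * (tokens a0 k * 4 ^ level a0 k) <= t * 4 ^ l.
  by apply: leq_trans (h _ _ erefl erefl); rewrite expnS leq_mul2l IHph orbT.
have half := step_half a true k; have okE := @step_tokens_ok a true k.
have tle : (K + K.-1) * tokens a0 k <= K * tokens a k -> tokens a0 k <= tokens a k.
  move=> h; rewrite -(leq_pmul2l K0); apply: leq_trans h.
  by rewrite leq_mul2r leq_addr orbT.
move=> tt ll; move: ll; rewrite [level _ _]/= /step_level lE -/a0 /= => <-.
case oka: (ok e idn K a k) => /=; last first.
  rewrite addn1 expnS !mulnA leq_mul2r; apply/orP; right.
  case: tE => [/tle tE|[np tE]]; first by rewrite -tt -/a0 in half tE *; lia.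
  by rewrite -tt /= /step_tokens oka np muln0 subn0; rewrite -/a0 in tE; lia.
rewrite addn0 mulnA leq_mul2r; apply/orP; right.
have le := oka; rewrite /ok in le; rewrite -tt okE //.
case: tE => [tE|[np tE]]; last by move: le; rewrite np muln0; rewrite -/a0 in tE; lia.
have : (K + K.-1) * tokens a0 k + tokens a0 k <= K * tokens a k + K * nprop e idn a k.
  by rewrite leq_add //; apply: leq_trans le; apply: tle.
by nia.
Qed.

(** * Properties of the final clustering *)

Variables (kappa L : nat).
Hypothesis PE : P = (4 * kappa + 10) * L.
Hypothesis L0 : 0 < L.
Hypothesis card_lt : #|V| < 2 ^ L.
Hypothesis idn_lt : forall v, idn v < 2 ^ (kappa * L).

Local Notation fin := (run (P * K)).

(** A lower level would, by [run_growth], force more tokens than [run_tokens] allows. *)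
Lemma final_level r : r \in S -> kappa * L <= level fin (idn r).
Proof.
move=> rS; rewrite leqNgt; apply/negP=> lt.
have := run_growth P rS; have := run_tokens (P * K) rS.
rewrite mulnK ?K_gt0 //; set t := tokens _ _; set l := level _ _ in lt * => tle gr.
(* [p] is half of [P]: [2 ^ p] absorbs the factor [3 * P + 2], and the other half exceeds the
   exponent [L + 2 * l] that comes from [#|S|] and [4 ^ l]. *)
pose p := (2 * kappa + 5) * L.
have Pp : P = p + p by rewrite PE /p; nia.
have p5 : 5 <= p by rewrite /p; nia.
have p2 : 3 * P + 2 <= 2 ^ p.
  rewrite Pp; elim: (p) p5 => // q IHq; rewrite leq_eqVlt => /predU1P[<- //|q5].
  by have := IHq q5; rewrite expnS; lia.
have : 2 ^ P < 2 ^ P; last by rewrite ltnn.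
apply: leq_ltn_trans gr _; apply: (@leq_ltn_trans (2 ^ L * 2 ^ p * 4 ^ l)).
  rewrite leq_mul2r (leq_trans tle) ?orbT // leq_mul //.
  exact: leq_trans (max_card _) (ltnW card_lt).
rewrite Pp expnD mulnAC ltn_mul2r expn_gt0 /= -[4]/(2 ^ 2) -expnM -expnD ltn_exp2l //.
by rewrite /p; nia.
Qed.

(** Labels have at most [kappa * L] bits, all used up at the final levels, so the congruence becomes
    an equality. *)
Lemma final_separated u v : e u v -> alive fin u -> alive fin v ->
  cluster fin u = cluster fin v.
Proof.
move=> euv au av; have w := run_wf (P * K).
have [q qS qE] := wf_center w (wf_cluster w au).
have [r rS rE] := wf_center w (wf_cluster w av).
have := run_agree euv au av; rewrite -qE -rE.
suff small x : idn x < 2 ^ minn (level fin (idn q)) (level fin (idn r)) by rewrite !modn_small.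
by apply: leq_trans (idn_lt x) _; rewrite leq_exp2l // leq_min !final_level.
Qed.

Lemma final_alive : #|S| <= 2 * #|[set v | alive fin v]|.
Proof.
have := run_credit (P * K); rewrite mulnK ?K_gt0 // /credit.
have -> : #|[set v | alive fin v]| = #|S :&: [set v | alive fin v]|.
  congr #|pred_of_set _|; apply/esym/setIidPr/subsetP=> v.
  by rewrite inE => /(wf_alive (run_wf _)).
have := cardsID [set v | alive fin v] S.
have : #|S :\: [set v | alive fin v]| * M <=
    \sum_(v in S) (if alive fin v then key fin (cluster fin v) else M).
  rewrite -sum_nat_const [leqRHS](bigID (alive fin)) /= addnC.
  rewrite (eq_bigl (fun v => (v \in S) && ~~ alive fin v)); last first.
    by move=> v; rewrite !inE andbC.
  apply: leq_trans (leq_addr _ _).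
  by apply: leq_sum => v /andP[_ /negbTE->].
rewrite /price; move: (\sum_(v in S) _) (\sum_(v in S) _) => x y; nia.
Qed.

(** Parent pointers are followed down to depth 0. Asking for edges of [e] as well lets one path
    serve both the tree radius and the weak-diameter. *)
Lemma final_root_path v (x : entry) : x \in forest fin v ->
  exists r p, [/\ r \in S, idn r = lab x, last v p = r, size p = dep x &
    path [rel u w | ((lab x, Some (idn w)) \in [seq (lab y, par y) | y <- forest fin u]) &&
                 e u w] v p].
Proof.
have w := run_wf (P * K).
move: {2}(dep x) (leqnn (dep x)) => d; elim: d v x => [|d IHd] v x.
all: case px: (par x) => [j|] dx xv.
- by have [u [y [_ _ _ _ dxE]]] := wf_par w xv px; rewrite dxE in dx.
all: try by have [xi d0] := wf_root w xv px; exists v, [::]; split=> //;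
  have [r rS rE] := wf_center w (map_f lab xv); rewrite -(idn_inj (etrans rE xi)).
have [u [y [ju evu yu yx dxE]]] := wf_par w xv px.
have [|r [p [rS rE pl ps pp]]] := IHd u y _ yu; first by rewrite dxE in dx.
exists r, (u :: p); split=> //=; rewrite ?ps ?rE ?dxE // -?yx // pp andbT evu andbT yx ju -px.
exact: (map_f (fun z => (lab z, par z))).
Qed.

Variable (o : V -> Output).
Hypothesis oE : forall v, o v =
  mkOutput (alive fin v) (cluster fin v) [seq (lab x, par x) | x <- forest fin v].

Lemma final_spec c : 2 * (P * K) <= c * L ^ 2 -> 3 * P + 2 <= c * L ->
  L = Lg #|V| -> theorem2p2_spec e idn S o c.
Proof.
move=> cD cF LE; have w := run_wf (P * K).
have alE v : inSp (o v) = alive fin v by rewrite oE.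
have laE v : label (o v) = cluster fin v by rewrite oE.
have trE v : trees (o v) = [seq (lab x, par x) | x <- forest fin v] by rewrite oE.
have fstE v : map fst (trees (o v)) = labs (forest fin v) by rewrite trE -map_comp.
have SpE : Sp o = [set v | alive fin v] by apply/setP=> v; rewrite !inE alE.
rewrite /theorem2p2_spec -LE SpE.
have root_path v k : in_tree o k v -> exists r p, [/\ r \in S, idn r = k, last v p = r,
    size p <= P * K & path [rel x y | tree_par idn o k x y && e x y] v p].
  rewrite /in_tree fstE => /mapP[x xv ->].
  have [r [p [rS rE pl ps pp]]] := final_root_path xv; exists r, p; split=> //.
    by rewrite ps (wf_dep w xv).
  by apply: sub_path pp => a b /=; rewrite /tree_par trE.
have in_own v : alive fin v -> in_tree o (cluster fin v) v.
  by move=> av; rewrite /in_tree fstE; apply: wf_cluster w _ av.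
split.
- by apply/subsetP=> v; rewrite inE => /(wf_alive w).
- exact: final_alive.
- by move=> u v euv; rewrite !inE !laE => au av; apply: final_separated.
- move=> u v; rewrite !inE !laE => au av uv.
  have [r [p [_ rE pl ps pp]]] := root_path _ _ (in_own u au).
  have [r' [q [_ rE' ql qs qq]]] := root_path _ _ (in_own v av).
  have rr : r' = r by apply: idn_inj; rewrite rE rE' uv.
  have ep : path e u p by apply: sub_path pp => x y /andP[].
  have eq : path e v q by apply: sub_path qq => x y /andP[].
  (* Both vertices reach the same root; the second path is reversed without repeating that root. *)
  exists (p ++ rev (belast v q)); split.
  + rewrite cat_path ep pl -rr -ql rev_path.
    by rewrite (eq_path (e' := e)) // => x y; rewrite e_sym.
  + rewrite last_cat pl -rr -ql; case: (q) => [|y q'] //=.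
    by rewrite rev_cons last_rcons.
  + rewrite size_cat size_rev size_belast; apply: leq_trans cD.
    by rewrite mul2n -addnn leq_add.
split.
- by move=> v; rewrite fstE (wf_uniq w).
- move=> k /existsP[u /andP[]]; rewrite alE laE => au /eqP ku.
  split.
  + move=> v j; rewrite trE => /mapP[x xv [kx jx]].
    have [t [y [ty evt yt yx _]]] := wf_par w xv (esym jx).
    by exists t; split=> //; rewrite /in_tree fstE kx -yx; apply: map_f.
  + have [r rS rE] := wf_center w (wf_cluster w au).
    exists r; split; last split.
    * rewrite trE -ku -rE; exact: (map_f (fun x => (lab x, par x)) (wf_self w rS)).
    * move=> r'; rewrite trE => /mapP[x xr [kx px]]; apply: idn_inj.
      by have [<- _] := wf_root w xr (esym px); rewrite -kx -ku.
    * move=> v /root_path[r' [p [_ rE' pl ps pp]]]; exists p; split.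
      - by apply: sub_path pp => x y /andP[].
      - by rewrite pl; apply: idn_inj; rewrite rE' rE ku.
      - by apply: leq_trans cD; apply: leq_trans ps _; rewrite leq_pmull.
  + by move=> v; rewrite alE laE => av <-; apply: in_own.
- move=> v; apply: leq_trans (count_size _ _) _; rewrite fstE size_map.
  by apply: leq_trans cF; have := run_forest (P * K) v; rewrite mulnK ?K_gt0 //; lia.
Qed.

End Run.

(** * Convergecast along the trees *)

Section TreeSum.
Variables (V : finType) (e : rel V) (idn : V -> nat) (S : {set V}).
Hypothesis idn_inj : injective idn.
Variables (s : nat) (a : conf V).
Hypothesis wa : wf e idn S s a.
Variables (D k : nat).
Hypothesis sD : s <= D.

Definition inT (v : V) : bool := k \in labs (forest a v).
Definition dpt (v : V) : nat := dep (lookup (forest a v) k).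
Definition parent (v : V) : option nat := par (lookup (forest a v) k).
Definition child (w u : V) : bool := inT u && (parent u == Some (idn w)).

Lemma childP w u : child w u -> [/\ inT w, e u w & dpt u = (dpt w).+1].
Proof.
move=> /andP[iu /eqP pu].
have [t [y [/idn_inj-> euw yw yl dE]]] := wf_par wa (lookup_mem iu) pu.
have yk : lab y = k by rewrite yl lab_lookup.
split=> //; first by rewrite /inT -yk map_f.
by rewrite /dpt dE -yk lookup_uniq // (wf_uniq wa).
Qed.

Lemma has_parent u : inT u -> 0 < dpt u -> exists w, child w u.
Proof.
move=> iu du; case pu: (parent u) => [j|].
  have [w [y [wj _ _ _ _]]] := wf_par wa (lookup_mem iu) pu.
  by exists w; rewrite /child iu pu wj eqxx.
by have [_ d0] := wf_root wa (lookup_mem iu) pu; rewrite /dpt d0 in du.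
Qed.

Lemma dpt_le u : inT u -> dpt u <= D.
Proof. by move=> iu; apply: leq_trans sD; apply/(wf_dep wa)/lookup_mem/iu. Qed.

Lemma dpt0 u : inT u -> dpt u = 0 -> idn u = k.
Proof.
move=> iu du; case pu: (parent u) => [j|].
  by have [w [y [_ _ _ _ dE]]] := wf_par wa (lookup_mem iu) pu; rewrite /dpt dE in du.
by have [<- _] := wf_root wa (lookup_mem iu) pu; rewrite lab_lookup.
Qed.

Lemma center_tree r : r \in S -> idn r = k -> [/\ inT r, dpt r = 0 & parent r = None].
Proof.
move=> rS rk; have xr := wf_self wa rS.
have := lookup_uniq (wf_uniq wa r) xr; rewrite /lab /= rk => E.
by rewrite /inT /dpt /parent E -rk; split=> //; apply: (map_f lab xr).
Qed.

Variable own : V -> nat.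

(** Sum of [own] over the descendants at most [n] levels below [v]; for [n = D - dpt v] this is the
    whole subtree. *)
Fixpoint total (n : nat) (v : V) : nat :=
  own v + (if n is n'.+1 then \sum_(u | child v u) total n' u else 0).

(** Induction from the deepest level upwards: a tree vertex at depth [d.+1] is the child of exactly
    one vertex, at depth [d]. *)
Lemma sum_total d : d <= D ->
  \sum_(v | inT v && (dpt v == d)) total (D - d) v =
  \sum_(v | inT v && (d <= dpt v)) own v.
Proof.
move=> dD; rewrite -(subKn dD); move: (D - d) (leq_subr d D) => n nD {d dD}.
elim: n nD => [|n IHn] nD.
  rewrite subn0 subnn; apply: eq_big => [v|v _]; last by rewrite /= addn0.
  by case iv: (inT v); rewrite //= eqn_leq dpt_le.
rewrite subKn //=; set d := D - n.+1.
have dE : D - n = d.+1 by rewrite /d; lia.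
have := IHn (ltnW nD); rewrite subKn ?(ltnW nD) // dE => {}IHn.
rewrite big_split /=.
have -> : \sum_(v | inT v && (dpt v == d)) \sum_(u | child v u) total n u =
          \sum_(u | inT u && (dpt u == d.+1)) total n u.
  pose pv u := odflt u [pick w | child w u].
  have pvE w u : child w u -> pv u = w.
    move=> cw; rewrite /pv; case: pickP => [t /andP[_ /eqP pt]|/(_ w)]; last by rewrite cw.
    by apply: idn_inj; move: cw => /andP[_]; rewrite pt => /eqP[].
  rewrite [RHS](partition_big pv (fun v => inT v && (dpt v == d))) /=.
    apply: eq_bigr => v /andP[iv /eqP dv]; apply: eq_bigl => u.
    apply/idP/idP => [cu|/andP[/andP[iu /eqP du] /eqP <-]].
      by have [_ _ ->] := childP cu; rewrite (pvE _ _ cu) dv !eqxx; case/andP: cu => ->.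
    by have [|w cw] := @has_parent u iu; rewrite ?du // (pvE _ _ cw).
  move=> u /andP[iu /eqP du]; have [|w cw] := @has_parent u iu; first by rewrite du.
  by rewrite (pvE _ _ cw); have [-> _] := childP cw; rewrite du => -[->]; rewrite eqxx.
rewrite IHn addnC [RHS](bigID (fun v => d < dpt v)) /=; congr (_ + _).
  by apply: eq_bigl => v; case: (inT v) => //=; lia.
by apply: eq_bigl => v; case: (inT v) => //=; lia.
Qed.

Lemma total_le v : inT v -> total (D - dpt v) v <= \sum_(u | inT u) own u.
Proof.
move=> iv; have := sum_total (dpt_le iv).
rewrite (bigD1 v) /= ?iv ?eqxx // => E.
apply: leq_trans (leq_trans (leq_addr _ _) (eq_leq E)) _.
rewrite [leqRHS](bigID (fun u => dpt v <= dpt u)) /=; apply: leq_addr.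
Qed.

Lemma total_root r : r \in S -> idn r = k -> total D r = \sum_(u | inT u) own u.
Proof.
move=> rS rk; have [ir dr _] := center_tree rS rk.
have := sum_total (leq0n D); rewrite subn0 (big_pred1 r) => [->|v /=].
  by apply: eq_bigl => v; rewrite andbT.
apply/andP/eqP => [[iv /eqP /(dpt0 iv)]|->]; last by rewrite ir dr.
by rewrite -rk => /idn_inj.
Qed.

(* Scaling by a power of two that depends on the depth makes the bits of the
   subtree totals arrive one round before they are needed by the parent. *)
Definition scaled (v : V) : nat := 2 ^ (D - dpt v) * total (D - dpt v) v.

(** Children lie one level deeper, hence the factor 2, which shifts their bits by one position. *)
Lemma scaledE w : inT w ->
  scaled w = 2 ^ (D - dpt w) * own w + 2 * \sum_(u | child w u) scaled u.
Proof.
move=> iw; rewrite /scaled; case E: (D - dpt w) => [|n] /=.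
  rewrite addn0 mul1n big_pred0 ?muln0 ?addn0 // => u; apply/negP=> cu.
  have [_ _ du] := childP cu; have /andP[/dpt_le] := cu; rewrite du; lia.
rewrite mulnDr; congr (_ + _); rewrite expnS -mulnA; congr (2 * _).
rewrite big_distrr; apply: eq_bigr => u /childP[_ _ ->].
by rewrite (_ : D - (dpt w).+1 = n) //; lia.
Qed.

Section Serial.
Variables (T : nat) (acc : V -> nat -> nat).
Hypothesis accE : forall w t, t <= T -> inT w ->
  acc w t = 2 ^ (D - dpt w) * own w +
            2 * \sum_(i < t) 2 ^ i * \sum_(u | child w u) bitn i (acc u i).

(** By strong induction the bits received before round [t] fix the children's values modulo [2 ^ t];
    doubling fixes this value modulo [2 ^ t.+1], which is enough for bit [t]. *)
Lemma bit_acc w t : t <= T -> inT w -> bitn t (acc w t) = bitn t (scaled w).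
Proof.
elim/ltn_ind: t w => t IHt w tT iw; apply: bitn_mod.
rewrite accE // scaledE // -modnDmr -[RHS]modnDmr; congr ((_ + _) %% _).
rewrite expnS -!muln_modr; congr (2 * _).
rewrite (eq_bigr (fun i : 'I_t => \sum_(u | child w u) 2 ^ i * bitn i (scaled u))).
  rewrite exchange_big -[RHS]modn_summ; congr (_ %% _).
  by apply: eq_bigr => u _; rewrite sum_bitn.
move=> i _; rewrite big_distrr; apply: eq_bigr => u cu.
by rewrite IHt //; [apply: leq_trans tT; apply: ltnW | case/andP: cu].
Qed.

Lemma acc_large w : inT w -> (forall u, child w u -> scaled u < 2 ^ T) ->
  acc w T = scaled w.
Proof.
move=> iw small; rewrite accE // scaledE //; congr (_ + 2 * _).
rewrite (eq_bigr (fun i : 'I_T => \sum_(u | child w u) 2 ^ i * bitn i (scaled u))).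
  by rewrite exchange_big; apply: eq_bigr => u /small lt; rewrite sum_bitn modn_small.
move=> i _; rewrite big_distrr; apply: eq_bigr => u cu.
by rewrite bit_acc //; [apply: ltnW | case/andP: cu].
Qed.

End Serial.
End TreeSum.

(** * The protocol *)

Definition log : Type := seq (nat -> seq bool).
Definition heard (lg : log) (i j : nat) : seq bool := nth (fun=> [::]) lg i j.

(* Local state between two steps; [cP] is the number of phases, and a tree is
   stored together with the current level of its cluster. *)
Record config := Config {
  cP : nat;
  cid : nat;
  cnbrs : seq nat;
  cstep : nat;
  calive : bool;
  ccl : nat;
  ctok : nat;
  ctrees : seq (entry * nat) }.

Definition clabs (c : config) : seq nat := [seq lab x.1 | x <- ctrees c].
Definition centry (c : config) (k : nat) : entry * nat :=
  nth (entry0, 0) (ctrees c) (index k (clabs c)).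

Section Local.
Variable P : nat.

(** Depths are bounded by the number of steps. The exchange has room for four numbers and up to
    [3 * P + 2] tree labels, the upward pass for all bits of values below [2 ^ (depth_bound + P)];
    then the verdict descends at most [depth_bound] levels. *)
Definition depth_bound : nat := P * nsteps P.
Definition exch_rounds : nat := 8 * P.
Definition up_start : nat := exch_rounds.+1.
Definition up_rounds : nat := depth_bound + P.
Definition down_start : nat := up_start + up_rounds.
Definition step_rounds : nat := down_start + depth_bound.+1.

Definition info (c : config) : seq nat :=
  [:: nat_of_bool (calive c), ccl c, (centry c (ccl c)).2, dep (centry c (ccl c)).1 & clabs c].

Definition told (lg : log) (q j : nat) : nat := dec (heard lg q j).
Definition told_labs (lg : log) (j : nat) : seq nat :=
  [seq told lg q j | q <- iota 4 (exch_rounds - 4)].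

(* The bit about tree [k] in the message that [j] sent in round [i]: bits are
   listed in the order of the tree labels told by [j] at the start of the step. *)
Definition tree_bit (lg : log) (i j k : nat) : bool :=
  nth false (heard lg i j) (index k (told_labs lg j)).

Variables (c : config) (lg : log).

Definition cprop : option nat :=
  if calive c then
    select (fun j => told lg 0 j != 0) (fun j => keyof (told lg 2 j) (told lg 1 j))
      (keyof (centry c (ccl c)).2 (ccl c)) (cnbrs c)
  else None.

Definition cown (k : nat) : nat :=
  (k == ccl c) * count (fun j => head false (heard lg exch_rounds j)) (cnbrs c).

Definition accu (x : entry) (t : nat) : nat :=
  2 ^ (depth_bound - dep x) * cown (lab x) +
  2 * \sum_(i < t) 2 ^ i * \sum_(j <- cnbrs c) tree_bit lg (up_start + i) j (lab x).

(** The division removes the scaling factor of depth 0, so the value is meaningful at roots only. *)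
Definition cnprop (x : entry) : nat := accu x up_rounds %/ 2 ^ depth_bound.

(** Away from the root this repeats what the parent sent last; values read too early may be
    wrong. *)
Definition verdict (x : entry) : bool :=
  if par x is Some j then tree_bit lg (size lg).-1 j (lab x)
  else ctok c <= nsteps P * cnprop x.

Definition message (j : nat) : seq bool :=
  let t := size lg in
  if t < exch_rounds then enc (nth 0 (info c) t)
  else if t < up_start then [:: cprop == Some j]
  else if t < down_start then
    [seq (par x.1 == Some j) && bitn (t - up_start) (accu x.1 (t - up_start)) | x <- ctrees c]
  else [seq verdict x.1 | x <- ctrees c].

(** Only a vertex of [S] has a tree labelled by its own identifier, and it keeps the tokens of that
    cluster. A new tree gets the level told at the start of the step, still valid because the
    cluster accepted. *)
Definition update : config :=
  let s := (cstep c).+1 in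
  let trs := [seq (x.1, x.2 + ((nsteps P %| s) && ~~ verdict x.1)) | x <- ctrees c] in
  let own := (cid c, None, 0) in
  let tok := if cid c \notin clabs c then ctok c
             else if verdict own then ctok c + cnprop own
             else ctok c - price P * cnprop own in
  if cprop is Some j then
    let k := told lg 1 j in
    if tree_bit lg (size lg).-1 j k then
      Config P (cid c) (cnbrs c) s true k tok
        (if k \in clabs c then trs
         else rcons trs ((k, Some j, (told lg 3 j).+1), told lg 2 j))
    else Config P (cid c) (cnbrs c) s false (ccl c) tok trs
  else Config P (cid c) (cnbrs c) s (calive c) (ccl c) tok trs.

End Local.

(** * One step of the protocol *)

Section Logs.
Variables (V : finType) (e : rel V) (idn : V -> nat).
Hypothesis idn_inj : injective idn.
Variables (P : nat) (cfg : V -> config).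

Fixpoint logs (t : nat) (v : V) : log :=
  if t is t'.+1 then
    rcons (logs t' v) (fun j =>
      if [pick u | e v u && (idn u == j)] is Some u
      then message P (cfg u) (logs t' u) (idn v) else [::])
  else [::].

Lemma size_logs t v : size (logs t v) = t.
Proof. by elim: t => //= t IHt; rewrite size_rcons IHt. Qed.

Lemma heard_logs t i v u : i < t -> e v u ->
  heard (logs t v) i (idn u) = message P (cfg u) (logs i u) (idn v).
Proof.
move=> + evu; elim: t => // t IHt; rewrite ltnS leq_eqVlt /heard /= nth_rcons size_logs.
case/predU1P=> [->|lt]; last by rewrite lt -IHt.
rewrite ltnn eqxx; case: pickP => [w /andP[_ /eqP/idn_inj-> //]|/(_ u)].
by rewrite evu eqxx.
Qed.

End Logs.

Section StepCorrect.
Variables (V : finType) (e : rel V) (idn : V -> nat) (S : {set V}).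
Hypothesis e_sym : symmetric e.
Hypothesis idn_inj : injective idn.
Variables (P s : nat) (a : conf V).
Hypothesis wa : wf e idn S s a.
Hypothesis sD : s <= depth_bound P.
Hypothesis forest_le : forall v, size (forest a v) + 4 <= exch_rounds P.
Hypothesis card_le : #|V| < 2 ^ P.

Local Notation E := (exch_rounds P).
Local Notation D := (depth_bound P).
Local Notation K := (nsteps P).

Definition conc (t : nat) (b : conf V) (v : V) : config := {|
  cP := P; cid := idn v; cnbrs := map idn (nbrs e idn v); cstep := t;
  calive := alive b v; ccl := cluster b v;
  ctok := if v \in S then tokens b (idn v) else 0;
  ctrees := [seq (x, level b (lab x)) | x <- forest b v] |}.

Local Notation cfg := (conc s a).
Local Notation lg := (logs e idn P cfg).

Lemma clabs_conc t b v : clabs (conc t b v) = labs (forest b v).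
Proof. by rewrite /clabs -map_comp. Qed.

Lemma centry_conc t b v k : k \in labs (forest b v) ->
  centry (conc t b v) k = (lookup (forest b v) k, level b k).
Proof.
move=> kv; rewrite /centry clabs_conc /= (nth_map entry0) -/(lookup _ _) ?lab_lookup //.
by rewrite -(size_map lab) index_mem.
Qed.

Lemma told_logs t v u q : E <= t -> e v u -> q < E ->
  told (lg t v) q (idn u) = nth 0 (info (cfg u)) q.
Proof.
move=> Et evu qE; rewrite /told (heard_logs idn_inj) ?(leq_trans qE) //.
by rewrite /message size_logs qE encK.
Qed.

Lemma told_labs_logs t v u : E <= t -> e v u ->
  told_labs P (lg t v) (idn u) =
  labs (forest a u) ++ nseq (E - 4 - size (forest a u)) 0.
Proof.
move=> Et evu; have le := forest_le u.
rewrite /told_labs -(clabs_conc s) -(size_map lab) -/(labs _) -(clabs_conc s).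
set n := size _; have nE : n + 4 <= E by rewrite /n clabs_conc size_map.
apply: (@eq_from_nth _ 0); first by rewrite size_map size_iota size_cat size_nseq -/n; lia.
move=> i; rewrite size_map size_iota => iE.
rewrite (nth_map 0) ?size_iota // nth_iota // told_logs //; last by lia.
rewrite nth_cat -/n nth_nseq if_same /info [4 + i]addnC !addnS addn0 /=.
by case: ltnP => // ni; rewrite nth_default.
Qed.

Lemma tree_bit_logs t v u i k (f : entry -> bool) : E <= t -> e v u ->
  heard (lg t v) i (idn u) = map f (forest a u) ->
  tree_bit P (lg t v) i (idn u) k = (k \in labs (forest a u)) && f (lookup (forest a u) k).
Proof.
move=> Et evu hE; rewrite /tree_bit hE told_labs_logs // index_cat.
(* An absent label gets an index in the zero padding or beyond, past the end of the message, where
   the bit defaults to [false]. *)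
case: ifP => [ku|nk] /=; last by rewrite nth_default // !size_map leq_addr.
by rewrite (nth_map entry0) // -(size_map lab) index_mem.
Qed.

Lemma info_cluster u : alive a u ->
  info (cfg u) = [:: 1, cluster a u, level a (cluster a u),
                  dep (lookup (forest a u) (cluster a u)) & labs (forest a u)].
Proof. by move=> au; rewrite /info clabs_conc /= centry_conc ?(wf_cluster wa) // au. Qed.

Lemma E_gt3 (v : V) : 3 < E. Proof. exact: leq_trans (leq_addl _ _) (forest_le v). Qed.

Lemma cprop_logs t v : E <= t -> cprop (cfg v) (lg t v) = omap idn (prop e idn a v).
Proof.
move=> Et; rewrite /cprop /prop /=; case: ifP => // av.
rewrite centry_conc ?(wf_cluster wa) //= select_map; congr omap.
have E3 := E_gt3 v.
have alE : {in nbrs e idn v, (fun j => told (lg t v) 0 j != 0) \o idn =1 alive a}.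
  move=> u; rewrite mem_nbrs => evu /=.
  by rewrite told_logs //; [rewrite /info /=; case: alive | apply: ltn_trans E3].
case: (@eq_select _ _ _ ((fun j => keyof (told (lg t v) 2 j) (told (lg t v) 1 j)) \o idn)
  (fun u => key a (cluster a u)) (keyof (level a (cluster a v)) (cluster a v)) _ alE) => // u uv.
rewrite alE // => au; move: uv; rewrite mem_nbrs => evu /=.
by rewrite !told_logs ?info_cluster //; apply: ltn_trans E3.
Qed.

Lemma heard_prop t v u : E < t -> e v u ->
  head false (heard (lg t v) E (idn u)) = (prop e idn a u == Some v).
Proof.
move=> Et evu; rewrite (heard_logs idn_inj) // /message size_logs ltnn /up_start ltnSn /=.
rewrite cprop_logs //; case: prop => [w|] //=.
by apply/eqP/eqP => [[/idn_inj->]|[->]].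
Qed.

Definition own (k : nat) (v : V) : nat :=
  (k == cluster a v) * #|[set u | prop e idn a u == Some v]|.

Lemma sum_nbrs v (f : nat -> nat) :
  \sum_(j <- map idn (nbrs e idn v)) f j = \sum_(u | e v u) f (idn u).
Proof.
by rewrite big_map (perm_big _ (permEl (perm_sort _ _))) big_filter big_enum_cond.
Qed.

Lemma cown_logs t v k : E < t -> cown P (cfg v) (lg t v) k = own k v.
Proof.
move=> Et; rewrite /cown /own; congr (_ * _).
rewrite -sum1_count big_mkcond sum_nbrs /= -sum1_card big_mkcond [RHS]big_mkcond /=.
apply: eq_bigr => u _; rewrite inE; case: ifP => [evu|nvu].
  by rewrite heard_prop //; case: ifP.
case: eqP => // /propP[_ _ euv _ _].
by rewrite e_sym euv in nvu.
Qed.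

(** Each proposal is counted at one tree vertex only: its addressee, on behalf of the cluster of
    that vertex. *)
Lemma sum_own k : \sum_(v | inT a k v) own k v = nprop e idn a k.
Proof.
have ownE v : own k v = \sum_u (k == cluster a v) * (prop e idn a u == Some v).
  rewrite -big_distrr /own -sum1_card big_mkcond; congr (_ * _).
  by apply: eq_bigr => u _; rewrite inE; case: eqP.
rewrite (eq_bigr _ (fun v _ => ownE v)) exchange_big /nprop -sum1_card [RHS]big_mkcond.
apply: eq_bigr => u _; rewrite inE /=.
case F: (prop e idn a u) => [w|]; last by rewrite big1 // => v _; rewrite muln0.
have [_ aw _ _ _] := propP F; rewrite /=; case: eqP => [[<-]|nk].
  rewrite (bigD1 w) /=; last by rewrite /inT (wf_cluster wa).
  rewrite !eqxx big1 // => v /andP[_ vw].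
  by rewrite (_ : (_ == Some v) = false) ?muln0 //; apply: contraNF vw => /eqP[->].
rewrite big1 // => v _; case: (Some w =P Some v) => [[<-]|]; last by rewrite muln0.
by rewrite (_ : (k == _) = false) //; apply/eqP=> kw; apply: nk; rewrite kw.
Qed.

(** * Upward and downward passes of a step *)

Local Notation up0 := (up_start P).
Local Notation down0 := (down_start P).
Local Notation U := (up_rounds P).

Lemma message_up u j t : t < U ->
  message P (cfg u) (lg (up0 + t) u) j =
  [seq (par x == Some j) && bitn t (accu P (cfg u) (lg (up0 + t) u) x t) | x <- forest a u].
Proof.
move=> tU; rewrite /message size_logs /down_start ltn_add2l tU addKn -map_comp.
by rewrite !ltnNge leq_addr (leq_trans (leqnSn _) (leq_addr _ _)).
Qed.

Definition acc (k : nat) (w : V) (t : nat) : nat :=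
  accu P (cfg w) (lg (up0 + t) w) (lookup (forest a w) k) t.

Lemma tree_bit_up k m w u i : i < U -> up0 + i < m -> e w u ->
  tree_bit P (lg m w) (up0 + i) (idn u) k = child idn a k w u && bitn i (acc k u i).
Proof.
move=> iU im ewu; have Em : E <= m by apply: leq_trans (ltnW im); rewrite addSnnS leq_addr.
rewrite (@tree_bit_logs _ _ _ _ _ (fun x => (par x == Some (idn w)) &&
  bitn i (accu P (cfg u) (lg (up0 + i) u) x i))) // ?heard_logs // ?message_up //.
by rewrite /child -andbA.
Qed.

Lemma accu_logs k m w t : t <= U -> inT a k w -> up0 + t <= m ->
  accu P (cfg w) (lg m w) (lookup (forest a w) k) t =
  2 ^ (D - dpt a k w) * own k w +
  2 * \sum_(i < t) 2 ^ i * \sum_(u | child idn a k w u) bitn i (acc k u i).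
Proof.
move=> tU iw tm; have Em : E < m by apply: leq_trans tm; apply: leq_addr.
rewrite /accu lab_lookup // cown_logs //; congr (_ + 2 * _).
apply: eq_bigr => i _; congr (_ * _); have it := ltn_ord i.
have im : up0 + i < m by apply: leq_trans tm; rewrite ltn_add2l.
rewrite sum_nbrs big_mkcond [RHS]big_mkcond; apply: eq_bigr => u _.
case: ifP => [ewu|nwu]; last first.
  by case: ifP => // /(childP idn_inj wa)[_ euw _]; rewrite e_sym euw in nwu.
by rewrite tree_bit_up ?(leq_trans it) //; case: child.
Qed.

Lemma accu_total k m w : inT a k w -> down0 <= m ->
  accu P (cfg w) (lg m w) (lookup (forest a w) k) U = scaled idn a D k (own k) w.
Proof.
move=> iw dm.
have accE v t : t <= U -> inT a k v -> acc k v t = 2 ^ (D - dpt a k v) * own k v +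
    2 * \sum_(i < t) 2 ^ i * \sum_(u | child idn a k v u) bitn i (acc k u i).
  by move=> tU iv; apply: accu_logs.
rewrite accu_logs // -accE //; apply: (acc_large idn_inj wa sD accE iw) => u /andP[iu _].
(* There is at most one proposal per vertex of the graph, whence [P] bits on top of the scaling. *)
rewrite /scaled /up_rounds expnD; apply: (@leq_ltn_trans (2 ^ D * #|V|)).
  rewrite leq_mul ?leq_exp2l ?leq_subr //.
  apply: leq_trans (total_le idn_inj wa sD _ iu) _.
  by rewrite sum_own; apply: max_card.
by rewrite ltn_mul2l expn_gt0.
Qed.

Lemma cnprop_center r m : r \in S -> down0 <= m ->
  cnprop P (cfg r) (lg m r) (idn r, None, 0) = nprop e idn a (idn r).
Proof.
move=> rS dm; have [ir dr _] := center_tree wa rS erefl.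
have xE : (idn r, None, 0) = lookup (forest a r) (idn r).
  by rewrite (lookup_uniq (wf_uniq wa r) (wf_self wa rS)).
rewrite /cnprop xE accu_total // /scaled dr subn0 mulKn ?expn_gt0 //.
by rewrite (total_root idn_inj wa sD _ rS) // sum_own.
Qed.

Lemma message_down u j i :
  message P (cfg u) (lg (down0 + i) u) j =
  [seq verdict P (cfg u) (lg (down0 + i) u) x | x <- forest a u].
Proof.
rewrite /message size_logs /down_start.
rewrite [_ < E]ltnNge [_ < up0]ltnNge [_ < up0 + _]ltnNge.
by rewrite leq_addr -addnA leq_addr (leq_trans (leqnSn E) (leq_addr _ _)) /= -map_comp.
Qed.

Lemma tree_bit_down v u k i : e v u ->
  tree_bit P (lg (down0 + i).+1 v) (down0 + i) (idn u) k =
  inT a k u && verdict P (cfg u) (lg (down0 + i) u) (lookup (forest a u) k).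
Proof.
move=> evu.
rewrite (@tree_bit_logs _ _ _ _ _ (verdict P (cfg u) (lg (down0 + i) u))) //.
  by rewrite leqW // /down_start /up_start -addnA addSnnS leq_addr.
by rewrite heard_logs // message_down.
Qed.

Lemma verdict_root v x m : x \in forest a v -> par x = None -> down0 <= m ->
  verdict P (cfg v) (lg m v) x = ok e idn K a (lab x).
Proof.
move=> xv px dm; have [lx d0] := wf_root wa xv px.
have [r rS] := wf_center wa (map_f lab xv); rewrite lx => /idn_inj rv.
have xE : x = (idn v, None, 0).
  by move: lx px d0; case: (x) => -[? ?] ?; rewrite /lab /par /dep /= => -> -> ->.
by rewrite -rv in xE *; rewrite /verdict px xE cnprop_center //= rS.
Qed.

(** In each round of the downward pass the verdict descends by one level. *)
Lemma verdict_logs i v x : x \in forest a v -> dep x <= i ->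
  verdict P (cfg v) (lg (down0 + i) v) x = ok e idn K a (lab x).
Proof.
elim: i v x => [|i IHi] v x xv dx.
all: case px: (par x) => [j|]; last by rewrite verdict_root ?leq_addr.
all: have [u [y [ju evu yu yx dE]]] := wf_par wa xv px; rewrite dE // in dx.
rewrite /verdict px -ju size_logs addnS /= tree_bit_down // -yx /inT map_f //=.
by rewrite (lookup_uniq (wf_uniq wa u) yu) IHi.
Qed.

Local Notation R := (step_rounds P).
Local Notation b := (astep e idn K (price P) (K %| s.+1) a).

Lemma update_logs v : update P (cfg v) (lg R v) = conc s.+1 b v.
Proof.
have : R = (down0 + D).+1 by rewrite /step_rounds addnS.
move: (R) => r RE.
have verdE x : x \in forest a v -> verdict P (cfg v) (lg r v) x = ok e idn K a (lab x).
  move=> xv; rewrite RE -addnS verdict_logs // leqW // (leq_trans _ sD) //.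
  exact: wf_dep wa _ _ xv.
have ER : E <= r by rewrite RE leqW // /down_start /up_start -addnA addSnnS leq_addr.
have E3 := E_gt3 v.
rewrite /update cprop_logs // clabs_conc.
set trs := [seq _ | x <- _]; set tok := if _ then _ else _.
have trsE : trs = [seq (x, level b (lab x)) | x <- forest a v].
  rewrite /trs -map_comp; apply/eq_in_map => x xv /=.
  by rewrite verdE.
have tokE : tok = if v \in S then tokens b (idn v) else 0.
  rewrite /tok /=; case vS: (v \in S).
    rewrite (map_f lab (wf_self wa vS)) /= (verdE _ (wf_self wa vS)) /= /step_tokens.
    by rewrite cnprop_center // RE leqW // leq_addr.
  rewrite ifT //; apply/negP=> /(wf_center wa)[q qS /idn_inj qv].
  by rewrite -qv qS in vS.
rewrite tokE trsE {tok trs tokE trsE} /conc /= /step_alive /step_cluster /step_forest.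
case F: (prop e idn a v) => [u|] /=; last by rewrite andbT.
have [av au evu _ _] := propP F.
have -> : told (lg r v) 1 (idn u) = cluster a u.
  by rewrite told_logs ?info_cluster //; apply: ltn_trans E3.
have -> : tree_bit P (lg r v) (size (lg r v)).-1 (idn u) (cluster a u) =
    ok e idn K a (cluster a u).
  have iu := wf_cluster wa au; rewrite size_logs RE /= tree_bit_down // /inT iu /=.
  rewrite verdict_logs ?lookup_mem ?lab_lookup // (leq_trans _ sD) //.
  exact: wf_dep wa _ _ (lookup_mem iu).
rewrite av /=; case oku: (ok _ _ _ _ _) => //=; congr Config.
case: ifP => //= _; rewrite map_rcons !told_logs ?info_cluster //; try exact: ltn_trans E3.
by rewrite /= /step_level /lab /= oku andbF addn0.
Qed.

(** * Message sizes *)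

Lemma size_message w v (l : log) j : 0 < w -> D < 2 ^ w ->
  (forall u, idn u < 2 ^ w) -> (forall u, cluster a u < 2 ^ w) ->
  (forall k, level a k < 2 ^ w) -> (forall u, size (forest a u) <= w) ->
  size (message P (cfg v) l j) <= w.
Proof.
move=> w0 Dw idw cw lw fw; rewrite /message.
have info_lt : all (fun x => x < 2 ^ w) (info (cfg v)).
  have w2 : 1 < 2 ^ w by rewrite -[1](expn0 2) ltn_exp2l.
  rewrite /= clabs_conc; apply/and5P; split=> //.
  - by apply: leq_trans w2; rewrite ltnS leq_b1.
  - rewrite /centry; case: (ltnP (index (cluster a v) (clabs (cfg v))) (size (ctrees (cfg v)))).
      by rewrite size_map => lt; rewrite (nth_map entry0) //= lw.
    by move=> ge; rewrite nth_default // expn_gt0.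
  - rewrite /centry; case: (ltnP (index (cluster a v) (clabs (cfg v))) (size (ctrees (cfg v)))).
      rewrite size_map => lt; rewrite (nth_map entry0) //=.
      by apply: leq_ltn_trans Dw; apply: leq_trans sD; apply/(wf_dep wa)/(mem_nth _ lt).
    by move=> ge; rewrite nth_default // expn_gt0.
  - by apply/allP=> k /(wf_center wa)[r _ <-].
case: ifP => _.
  apply: size_enc => //; case: (ltnP (size l) (size (info (cfg v)))) => [lt|ge].
    exact: (allP info_lt) (mem_nth _ lt).
  by rewrite nth_default // expn_gt0.
by case: ifP => _ //; case: ifP => _; rewrite !size_map.
Qed.

End StepCorrect.

(** * The algorithm *)

Section Algorithm.
Variable kappa : nat.

Definition phases (n : nat) : nat := (4 * kappa + 10) * Lg n.

(** The state records the number of phases because [send] and [step] are not given [n]. A step of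
    the process ends when its log is full, and the log is then emptied. *)
Definition algorithm : Algo := {|
  St := config * log;
  init := fun n i s ns =>
    (Config (phases n) i ns 0 s i s (if s then [:: (i, None, 0, 0)] else [::]), [::]);
  send := fun st j => message (cP st.1) st.1 st.2 j;
  step := fun st rcv =>
    let lg := rcons st.2 rcv in
    if size lg == step_rounds (cP st.1) then (update (cP st.1) st.1 lg, [::]) else (st.1, lg);
  rounds := fun n =>
    let P := phases n in P * nsteps P * step_rounds P;
  out := fun st => mkOutput (calive st.1) (ccl st.1) [seq (lab x.1, par x.1) | x <- ctrees st.1] |}.

Variables (V : finType) (e : rel V) (idn : V -> nat).
Hypothesis e_sym : symmetric e.
Hypothesis idn_inj : injective idn.
Hypothesis idn_lt : forall v, idn v < 2 ^ (kappa * Lg #|V|).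
Variable S : {set V}.

Local Notation L := (Lg #|V|).
Local Notation P := (phases #|V|).
Local Notation K := (nsteps P).
Local Notation R := (step_rounds P).
Local Notation conf_at := (run e idn S P).
Local Notation cfg s := (conc e idn S P s (conf_at s)).

Lemma Lg_gt0 n : 0 < Lg n. Proof. by []. Qed.

Lemma phases_gt9 : 9 < P.
Proof. by rewrite /phases; have := Lg_gt0 #|V|; nia. Qed.

Lemma phases_gt0 : 0 < P.
Proof. exact: ltn_trans phases_gt9. Qed.

Lemma card_lt_Lg : #|V| < 2 ^ L.
Proof. exact: trunc_log_ltn. Qed.

Lemma card_lt_phases : #|V| < 2 ^ P.
Proof.
by apply: leq_trans card_lt_Lg _; rewrite leq_exp2l // /phases leq_pmull // addn_gt0 orbT.
Qed.

Lemma forest_size s v : s <= P * K -> size (forest (conf_at s) v) <= 3 * P + 2.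
Proof.
move=> sPK; have := run_forest e idn S phases_gt0 s v.
have : s %/ K <= P by rewrite -[leqRHS](mulnK _ (K_gt0 phases_gt0)) leq_div2r.
lia.
Qed.

(** * Simulation of the process by the algorithm *)

Lemma state_in_step s t v : t < R ->
    (forall u, state algorithm e idn S (s * R) u = (cfg s u, [::])) ->
  state algorithm e idn S (s * R + t) v = (cfg s v, logs e idn P (cfg s) t v).
Proof.
move=> + st0; elim: t v => [|t IHt] v tR; first by rewrite addn0.
rewrite addnS [state _ _ _ _ _ _]/= (IHt v (ltnW tR)) [size _]/= size_rcons size_logs.
rewrite (ltn_eqF tR); congr (_, rcons _ _); apply: functional_extensionality => j.
by case: pickP => // u _; rewrite (IHt u (ltnW tR)).
Qed.

Lemma exch_bound s v : s <= P * K -> size (forest (conf_at s) v) + 4 <= exch_rounds P.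
Proof.
move=> sD; have := forest_size v sD; have := phases_gt9; rewrite /exch_rounds; lia.
Qed.

Lemma state_next s : s < P * K ->
    (forall u, state algorithm e idn S (s * R) u = (cfg s u, [::])) ->
  forall v, state algorithm e idn S (s.+1 * R) v = (cfg s.+1 v, [::]).
Proof.
move=> sD st0 v.
have [r RE] : exists r, R = r.+1 by exists (down_start P + depth_bound P); apply: addnS.
have upd := update_logs e_sym idn_inj (run_wf e idn S P s) (ltnW sD)
  (fun u => exch_bound u (ltnW sD)) card_lt_phases v.
have rR : r < R by rewrite RE.
have st u := state_in_step u rR st0.
have -> : s.+1 * R = (s * R + r).+1 by rewrite mulSn addnC -addnS -RE.
rewrite [state _ _ _ _ _ _]/= st [size _]/= size_rcons size_logs -RE eqxx.
congr (_, _); rewrite -[RHS]upd [in RHS]RE /=; congr (update _ _ (rcons _ _)).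
by apply: functional_extensionality => j; case: pickP => // u _; rewrite st.
Qed.

Lemma state_start v : state algorithm e idn S 0 v = (cfg 0 v, [::]).
Proof. by rewrite /= nbr_idsE /conc /=; case: ifP. Qed.

Lemma state_conf s v : s <= P * K -> state algorithm e idn S (s * R) v = (cfg s v, [::]).
Proof.
elim: s v => [|s IHs] v sD; first exact: state_start.
by apply: state_next => // u; apply/IHs/ltnW.
Qed.

(** This covers vertices that are dead or outside [S], whose cluster is transmitted as well. *)
Lemma run_cluster s v : exists r, cluster (conf_at s) v = idn r.
Proof.
elim: s v => [|s IHs] v /=; first by exists v.
by rewrite /step_cluster; case: prop => // u; case: ifP.
Qed.

Lemma run_level s k : level (conf_at s) k <= s.
Proof.
elim: s => //= s IHs; rewrite /step_level -addn1 leq_add //.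
by case: (_ && _).
Qed.

Lemma leq_scale c i j m : 0 < j -> j <= i -> c * (m * L) ^ j <= c * m ^ i * L ^ j.
Proof.
move=> j0 ji; rewrite expnMn mulnA leq_mul2r leq_mul2l; apply/orP; right; apply/orP; right.
by case: m => [|m]; [rewrite exp0n | rewrite leq_pexp2l].
Qed.

(** 688 is 16 times 43: there are [16 * P ^ 2] steps, and each takes [32 * P ^ 2 + 9 * P + 2]
    rounds, at most [43 * P ^ 2]. *)
Definition factor : nat := 688 * (4 * kappa + 10) ^ 4.

Lemma factor_phases : 688 * P <= factor * L.
Proof. by have := @leq_scale 688 4 1 (4 * kappa + 10); rewrite !expn1; apply. Qed.

Lemma rounds_factor : rounds algorithm #|V| <= factor * L ^ 4.
Proof.
apply: leq_trans (@leq_scale 688 4 4 _ isT isT); rewrite -/P /=.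
rewrite /step_rounds /down_start /up_rounds /up_start /exch_rounds /depth_bound /nsteps.
have := phases_gt9; set p := P => p9.
have -> : 688 * p ^ 4 = p * (16 * p) * (43 * (p * p)) by rewrite !expnS expn0; nia.
by rewrite leq_mul //; nia.
Qed.

Lemma bandwidth_factor : bandwidth_ok algorithm e idn S (factor * L).
Proof.
move=> r u v; rewrite [rounds _ _]/= => rlt _.
have R0 : 0 < R by [].
have sD : r %/ R < P * K by rewrite ltn_divLR.
rewrite (divn_eq r R) state_in_step ?ltn_pmod //; last by move=> w; apply/state_conf/ltnW.
have fP := factor_phases; have p9 := phases_gt9; set w := factor * L in fP *.
have Dw : P * K < 2 ^ w.
  apply: (@leq_trans (2 ^ (4 + (P + P)))); last by rewrite leq_exp2l //; lia.
  by rewrite /nsteps !expnD; have := ltn_expl P (isT : 1 < 2); nia.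
have idw x : idn x < 2 ^ w.
  apply: leq_trans (idn_lt x) _; rewrite leq_exp2l //.
  by apply: leq_trans fP; rewrite /phases; nia.
apply: (size_message (run_wf e idn S P (r %/ R)) (ltnW sD)) => //; first by lia.
- by move=> x; have [y ->] := run_cluster (r %/ R) x.
- by move=> k; apply: leq_ltn_trans (run_level _ _) (ltn_trans sD Dw).
- by move=> x; have := forest_size x (ltnW sD); lia.
Qed.

Lemma spec_factor : theorem2p2_spec e idn S (output algorithm e idn S) factor.
Proof.
have p9 := phases_gt9.
apply: (final_spec e_sym idn_inj phases_gt0 (erefl P) (Lg_gt0 _) card_lt_Lg idn_lt) => //.
- move=> v; rewrite /output [rounds _ _]/= state_conf //=.
  by rewrite -map_comp.
- apply: leq_trans (@leq_scale 688 4 2 _ isT isT); rewrite -/P /nsteps !expnS expn0; nia.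
- by apply: leq_trans factor_phases; lia.
Qed.

End Algorithm.

Theorem theorem2p2 (kappa : nat) :
  exists (A : Algo) (c : nat),
  forall (V : finType) (e : rel V),
    symmetric e -> irreflexive e ->
  forall (id : V -> nat),
    injective id -> (forall v, id v < 2 ^ (kappa * Lg #|V|)) ->
  forall (S : {set V}),
    [/\ rounds A #|V| <= c * Lg #|V| ^ 4,
        bandwidth_ok A e id S (c * Lg #|V|)
      & theorem2p2_spec e id S (output A e id S) c].
Proof.
exists (algorithm kappa), (factor kappa) => V e e_sym _ id id_inj id_lt S; split.
- exact: rounds_factor.
- exact: bandwidth_factor.
- exact: spec_factor.
Qed.
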